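(* Let $n>4$ be an integer, let $a,b,c\in\mathbb{Z}$ with $abc\neq0$, and suppose $n^2=ak$ for some $k\in\mathbb{N}$. Let $\theta$ be an algebraic integer whose minimal polynomial over $\mathbb{Q}$ is $f(x)=x^n+ax^{n-1}+bx+c$, let $K=\mathbb{Q}(\theta)$, let $\mathcal{O}_K$ be the ring of algebraic integers of $K$, and let $D$ be the discriminant of $f(x)$. If an odd prime $p$ satisfies one of the following conditions: (1) $p\nmid a$, $p\nmid c$, $p\mid b$ and $p\mid n$; (2) $p\nmid a$, $p\nmid b$, $p\mid c$ and $p\mid(n-2)$; then $p\nmid[\mathcal{O}_K:\mathbb{Z}[\theta]]$ and $p\nmid D$.
   Context: $[\mathcal{O}_K:\mathbb{Z}[\theta]]$ is the index of $\mathbb{Z}[\theta]$ in $\mathcal{O}_K$ as additive groups. *)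

(* Defs.v *)
From mathcomp Require Import all_boot all_order all_algebra all_field.
From mathcomp Require Import finmap.
From mathcomp Require Import boolp classical_sets cardinality.

Set Implicit Arguments.
Unset Strict Implicit.
Unset Printing Implicit Defensive.

Import GRing.Theory.

Local Open Scope classical_set_scope.
Local Open Scope ring_scope.

Definition quadrinomial (n : nat) (a b c : int) : {poly int} :=
  'X^n + a *: 'X^(n - 1) + b *: 'X + c%:P.

(* (-1)^(n(n-1)/2) Res(f, f') / lc(f), with n = deg f.  The division is exact.
   The library's Sylvester matrix lists coefficients in increasing degree; this
   changes the usual resultant by (-1)^(n(n-1)) = 1 only, since deg f' = n-1. *)
Definition discriminant (f : {poly int}) : int :=
  ((-1) ^+ 'C((size f).-1, 2) * resultant f f^`() %/ lead_coef f)%Z.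

Definition add_coset (V : zmodType) (H : set V) (x : V) : set V :=
  [set x + h | h in H].

(* [G : H] for additive subgroups H of G; since fset_set sends infinite sets to
   fset0, it is 0 when the index is infinite. *)
Definition add_index (V : zmodType) (G H : set V) : nat :=
  #|` fset_set [set add_coset H x | x in G]|.

Definition ring_of_integers (L : fieldExtType rat) (K : {subfield L}) : set L :=
  [set x | x \in K /\ integralOver (intr : int -> L) x].

Definition int_adjoin (R : nzRingType) (x : R) : set R :=
  range (fun q : {poly int} => (map_poly intr q).[x]).

(* Main.v *)
Require Import Defs.
From mathcomp Require Import finmap boolp classical_sets cardinality.
From mathcomp Require Import all_boot all_order all_algebra all_fingroup.
From mathcomp Require Import all_field ring.

Set Implicit Arguments.
Unset Strict Implicit.
Unset Printing Implicit Defensive.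

Import GRing.Theory Num.Theory.

Local Open Scope ring_scope.

(** Both claims come down to [p] not dividing [D = Res(f, f')], which is the
    discriminant up to sign.

    Modulo [p] the quadrinomial degenerates so much that it is visibly
    separable.  In the first case [f' = - a X^(n-2)] while [f(0) = c] is
    nonzero; in the second [X f' - f = X^n] while [f'(0) = b] is nonzero.  So a
    common factor of [f] and [f'] divides a power of [X], yet is prime to [X]
    ([quadrinomial_coprime_deriv]).  Coprimality over ['F_p] passes to the
    integral resultant by [resultant_map_neq0], which allows for the drop in
    the degree of [f'] that occurs in the first case.

    That the index is prime to [p] follows because it divides a power of [D];
    in particular it is finite.  The key is Euler's inclusion
    [f'(theta) O_K <= Z[theta]] ([euler_derivative_integral]): if
    [alpha = g(theta)] is integral, the polynomial
    [sum_z g(z) f(X) / (X - z)], over the complex roots [z] of [f], has integer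
    coefficients and takes the value [alpha f'(theta)] at [theta].  As
    [D = u f + v f'] with integral [u] and [v], also [D O_K <= Z[theta]]
    ([resultant_deriv_mul_integral]).  Sending [alpha] to the coordinates of
    [D alpha] modulo [D] then embeds [O_K / Z[theta]] into [(Z/D)^n], and
    Lagrange's theorem concludes ([add_index_int_adjoin_dvd]). *)

(** * Resultants under reduction *)

(** The degree of [g] may drop under [phi], so [phi (resultant f g)] need not be
    the resultant of the images.  Still, a row vector killed by the image of the
    Sylvester matrix is a relation [u f + v g = 0] with [deg v < deg f], and
    coprimality forces [u = v = 0]. *)
Lemma resultant_map_neq0 (R : nzRingType) (F : fieldType)
    (phi : {rmorphism R -> F}) (f g : {poly R}) :
  f \is monic ->
  coprimep (map_poly phi f) (map_poly phi g) -> phi (resultant f g) != 0.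
Proof.
move=> f_monic cop_fg.
have fphi_monic : map_poly phi f \is monic by rewrite monic_map.
have sz_f : size (map_poly phi f) = size f.
  by rewrite size_map_poly_id0 // (monicP f_monic) rmorph1 oner_eq0.
rewrite -det_map_mx; apply/negP => /det0P [uv nz_uv].
rewrite /Sylvester_mx map_col_mx.
rewrite (map_lin1_mx (gf := poly_rV \o map_poly phi f \o* rVpoly)); last first.
  by move=> v; rewrite /= map_poly_rV rmorphM /= map_rVpoly.
rewrite (map_lin1_mx (gf := poly_rV \o map_poly phi g \o* rVpoly)); last first.
  by move=> v; rewrite /= map_poly_rV rmorphM /= map_rVpoly.
rewrite -[uv]hsubmxK mul_row_col !mul_rV_lin1 /= -raddfD /=.
set u := rVpoly _; set v := rVpoly _ => uv0.
have szuv : (size (u * map_poly phi f + v * map_poly phi g)%R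
   <= (size g).-1 + (size f).-1)%N.
  have szM m (w : 'rV[F]_m) (q : {poly F}) d : (size q <= d)%N ->
      (size (rVpoly w * q)%R <= m + d.-1)%N.
    move=> szq; have [->|nzw] := eqVneq (rVpoly w) 0.
      by rewrite mul0r size_poly0.
    have [->|nzq] := eqVneq q 0; first by rewrite mulr0 size_poly0.
    rewrite size_mul // -subn1 -addnBA ?size_poly_gt0 // subn1.
    by rewrite leq_add ?size_poly // -!subn1 leq_sub2r.
  rewrite (leq_trans (size_polyD _ _)) // geq_max szM ?sz_f //= addnC szM //.
  exact: size_poly.
have {}uv0 : u * map_poly phi f + v * map_poly phi g = 0.
  by rewrite -[LHS](poly_rV_K szuv) uv0 raddf0.
have v0 : v = 0.
  apply/eqP; apply: contraT => nz_v.
  have : map_poly phi f %| v.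
    rewrite -(Gauss_dvdpl _ cop_fg) -(dvdp_addr _ (dvdp_mull u (dvdpp _))).
    by rewrite uv0 dvdp0.
  move/(dvdp_leq nz_v); rewrite sz_f leqNgt => /negP [].
  rewrite (leq_ltn_trans (size_poly _ _)) // prednK // size_poly_gt0.
  exact: monic_neq0.
have u0 : u = 0.
  move/eqP: uv0; rewrite v0 mul0r addr0 mulf_eq0.
  rewrite (negbTE (monic_neq0 fphi_monic)) orbF.
  by move/eqP.
move/negP: nz_uv; apply.
rewrite -[uv]hsubmxK -[lsubmx _]rVpolyK -[rsubmx _]rVpolyK.
by rewrite -/u -/v u0 v0 !linear0 row_mx0.
Qed.

Lemma size_deriv (R : numDomainType) (f : {poly R}) : size f^`() = (size f).-1.
Proof.
have [->|nz_f] := eqVneq f 0; first by rewrite deriv0 size_poly0.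
apply/eqP; rewrite eqn_leq -ltnS prednK ?size_poly_gt0 // lt_size_deriv //=.
case sz_f: (size f) => [|[|m]] //=; rewrite ltnNge; apply/negP.
move/leq_sizeP/(_ m (leqnn m))/eqP; rewrite coef_deriv mulrn_eq0 /=.
have -> : f`_m.+1 = lead_coef f by rewrite lead_coefE sz_f.
by rewrite lead_coef_eq0 (negbTE nz_f).
Qed.

Lemma separable_resultant_deriv (f : {poly int}) :
  (2 < size f)%N -> resultant f f^`() != 0 ->
  separable_poly (map_poly intr f : {poly rat}).
Proof.
move=> sz_f nz_D.
have [|[u v] _ /= uv] := resultant_in_ideal (ltnW sz_f) (q := f^`()).
  by rewrite size_deriv -ltnS prednK // (leq_trans _ sz_f).
rewrite separable_poly.unlock; apply/Bezout_coprimepP.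
exists (map_poly intr u, map_poly intr v) => /=.
rewrite deriv_map -!rmorphM -rmorphD -uv /= map_polyC /=.
by rewrite polyC_eqp1 intr_eq0.
Qed.

(** * Euler's inclusion *)

(** Here [h(theta) = g(theta) f'(theta)] for a root [theta] of [f].  The
    remainder of [g f'] modulo [f] is rational and, by Lagrange interpolation at
    the complex roots of [f], equals [sum_z g(z) f(X) / (X - z)], whose
    coefficients are algebraic integers; rational algebraic integers are
    integers. *)
Lemma euler_derivative_integral (f : {poly int}) (g : {poly rat}) :
  f \is monic -> separable_poly (map_poly intr f : {poly rat}) ->
  (forall z : algC, root (map_poly intr f) z -> (map_poly ratr g).[z] \in Aint) ->
  exists2 h : {poly int}, (size h < size f)%N &
    map_poly intr f %| g * map_poly intr f^`() - map_poly intr h.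
Proof.
move=> f_monic f_sep g_int.
pose fQ : {poly rat} := map_poly intr f.
pose fC : {poly algC} := map_poly intr f.
have fQ_C : map_poly ratr fQ = fC.
  by rewrite -map_poly_comp; apply: eq_map_poly => x; rewrite /= rmorph_int.
have fC_monic : fC \is monic by rewrite monic_map.
have fQ_monic : fQ \is monic by rewrite monic_map.
have sz_fC : size fC = size f.
  by rewrite size_map_poly_id0 // (monicP f_monic) oner_eq0.
have sz_fQ : size fQ = size f.
  by rewrite size_map_poly_id0 // (monicP f_monic) oner_eq0.
have [r fC_r] := closed_field_poly_normal fC.
rewrite (monicP fC_monic) scale1r in fC_r.
have r_uniq : uniq r.
  by rewrite -separable_prod_XsubC -fC_r -fQ_C separable_map.
have sz_r : size f = (size r).+1 by rewrite -sz_fC fC_r size_prod_XsubC.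
have fC_root z : root fC z = (z \in r) by rewrite fC_r root_prod_XsubC.
have r_int z : z \in r -> z \in Aint.
  rewrite -fC_root => rz; apply: root_monic_Aint rz fC_monic _.
  by apply/polyOverP => i; rewrite coef_map /= rpred_int.
(* [cof z] is [f / (X - z)]. *)
pose cof z : {poly algC} := \prod_(y <- r | y != z) ('X - y%:P).
have fC_cof z : z \in r -> fC = ('X - z%:P) * cof z.
  by move=> rz; rewrite fC_r (bigD1_seq z).
have deriv_cof z : z \in r -> (fC^`()).[z] = (cof z).[z].
  move=> rz; rewrite (fC_cof z rz) derivM derivXsubC mul1r.
  by rewrite !hornerE subrr mul0r addr0.
have sz_cof z : z \in r -> size (cof z) = size r.
  move=> rz; have := sz_fC; rewrite sz_r (fC_cof z rz) size_monicM ?monicXsubC //.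
    by rewrite size_XsubC => -[].
  apply: contraTneq fC_monic => e.
  by rewrite (fC_cof z rz) e mulr0 monicE lead_coef0 eq_sym oner_eq0.
pose gC : {poly algC} := map_poly ratr g.
pose P := \sum_(z <- r) gC.[z] *: cof z.
have P_int : P \is a polyOver Aint.
  rewrite /P big_seq rpred_sum // => z rz; rewrite polyOverZ ?g_int ?fC_root //.
  rewrite /cof big_seq_cond rpred_prod // => y /andP [ry _].
  by rewrite polyOverXsubC r_int.
have P_r z : z \in r -> P.[z] = gC.[z] * (cof z).[z].
  move=> rz; rewrite /P horner_sum (bigD1_seq z) //= hornerZ big1_seq ?addr0 //.
  move=> y /andP [yz ry]; rewrite hornerZ.
  have : root ('X - y%:P) z || root (cof y) z.
    by rewrite -rootM -fC_cof // fC_root.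
  by rewrite root_XsubC eq_sym (negbTE yz) /= => /rootP ->; rewrite mulr0.
pose h := (g * fQ^`()) %% fQ.
have sz_h : (size h < size f)%N by rewrite -sz_fQ ltn_modp monic_neq0.
have h_P : map_poly ratr h = P.
  apply/eqP; rewrite -subr_eq0; apply/eqP.
  apply: (roots_geq_poly_eq0 (rs := r)) => //.
    apply/allP => z rz; rewrite rootE hornerD hornerN P_r // -deriv_cof //.
    have /(congr1 (fun p => (map_poly ratr p : {poly algC}).[z])) :=
      divp_eq (g * fQ^`()) fQ.
    have /rootP fz0 : root fC z by rewrite fC_root.
    rewrite !rmorphD !rmorphM /= fQ_C -deriv_map fQ_C !hornerE fz0 mulr0 add0r.
    by rewrite -/gC => ->; rewrite subrr.
  rewrite (leq_trans (size_polyD _ _)) // geq_max size_polyN size_map_poly.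
  rewrite -ltnS -sz_r sz_h /= /P big_seq.
  rewrite (leq_trans (size_sum _ _ _)) //.
  apply/bigmax_leqP_seq => z rz _.
  by rewrite (leq_trans (size_scale_leq _ _)) ?sz_cof.
have h_int i : h`_i = (numq h`_i)%:~R.
  have : ratr h`_i \is a @Num.int algC.
    rewrite Cint_rat_Aint ?Crat_rat // -coef_map h_P; exact: (polyOverP P_int).
  case/intrP => m; rewrite -(ratr_int _ m) => /fmorph_inj ->.
  by rewrite numq_int.
exists (map_poly numq h).
  by rewrite (leq_ltn_trans _ sz_h) // size_poly.
rewrite -map_poly_comp_id0 //.
suff -> : map_poly (intr \o numq) h = h.
  rewrite -deriv_map -/fQ {1}(divp_eq (g * fQ^`()) fQ) addrK.
  exact: dvdp_mull.
by apply/polyP => i; rewrite coef_map_id0 //= -h_int.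
Qed.

Lemma map_in_alg_intr (L : fieldExtType rat) (q : {poly int}) :
  map_poly (in_alg L) (map_poly intr q) = map_poly intr q.
Proof.
rewrite -map_poly_comp; apply: eq_map_poly => x.
exact: (rmorph_int (in_alg L)).
Qed.

Lemma root_dvd_rat (L : fieldExtType rat) (theta : L) (f : {poly int})
    (g : {poly rat}) :
  minPoly 1 theta = map_poly intr f ->
  root (map_poly (in_alg L) g) theta -> map_poly intr f %| g.
Proof.
move=> minf gt; rewrite -(dvdp_map (in_alg L)) map_in_alg_intr -minf.
apply: minPoly_dvdp gt; apply/polyOver1P; by exists g.
Qed.

Lemma dvd_rat_root (L : fieldExtType rat) (theta : L) (f : {poly int})
    (g : {poly rat}) :
  minPoly 1 theta = map_poly intr f ->
  map_poly intr f %| g -> (map_poly (in_alg L) g).[theta] = 0.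
Proof.
move=> minf.
rewrite -(dvdp_map (in_alg L)) map_in_alg_intr -minf => /dvdpP [q ->].
by rewrite hornerM (rootP (root_minPoly _ _)) mulr0.
Qed.

(** Conjugates of integral elements are integral: a monic [q] with
    [q(g(theta)) = 0] makes [f] divide [q o g], so [q] also kills [g(z)]. *)
Lemma conj_integral (L : fieldExtType rat) (theta : L) (f : {poly int})
    (g : {poly rat}) (z : algC) :
  minPoly 1 theta = map_poly intr f ->
  integralOver (intr : int -> L) (map_poly (in_alg L) g).[theta] ->
  root (map_poly intr f) z -> (map_poly ratr g).[z] \in Aint.
Proof.
move=> minf [q q_monic /rootP qg] fz.
have ratr_intr (s : {poly int}) :
    map_poly ratr (map_poly intr s : {poly rat}) = map_poly intr s :> {poly algC}.
  by rewrite -map_poly_comp; apply: eq_map_poly => x; rewrite /= rmorph_int.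
have : map_poly intr f %| map_poly intr q \Po g.
  apply: (root_dvd_rat minf).
  by rewrite map_comp_poly map_in_alg_intr rootE horner_comp qg.
rewrite -(dvdp_map (ratr : rat -> algC)) map_comp_poly !ratr_intr.
case/dvdpP => w /(congr1 (horner^~ z)).
rewrite horner_comp hornerM (rootP fz) mulr0 => /rootP qz.
apply: root_monic_Aint qz _ _; first by rewrite monic_map.
by apply/polyOverP => i; rewrite coef_map /= rpred_int.
Qed.

Lemma resultant_deriv_mul_integral (L : fieldExtType rat) (theta : L)
    (f : {poly int}) (alpha : L) :
  minPoly 1 theta = map_poly intr f ->
  f \is monic -> (2 < size f)%N -> resultant f f^`() != 0 ->
  alpha \in <<1; theta>>%VS -> integralOver (intr : int -> L) alpha ->
  exists q : {poly int},
    (map_poly intr q).[theta] = alpha *~ resultant f f^`().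
Proof.
move=> minf f_monic sz_f nz_D /Fadjoin_polyP [_ /polyOver1P [g ->] ->] alpha_int.
have f_sep := separable_resultant_deriv sz_f nz_D.
have [h _ /(dvd_rat_root minf)] := euler_derivative_integral f_monic f_sep
  (fun z => conj_integral minf alpha_int).
rewrite rmorphB rmorphM /= !map_in_alg_intr hornerD hornerN hornerM.
move/subr0_eq => gh.
have [|[u v] _ /= uv] := resultant_in_ideal (ltnW sz_f) (q := f^`()).
  by rewrite size_deriv -ltnS prednK // (leq_trans _ sz_f).
exists (v * h); rewrite rmorphM /= hornerM -gh mulrCA -mulrzr; congr (_ * _).
have := congr1
  (fun s : {poly int} => (map_poly intr s : {poly L}).[theta]) uv.
rewrite /= rmorphD !rmorphM /= !hornerE -minf (rootP (root_minPoly _ _)).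
by rewrite mulr0 add0r map_polyC hornerC => ->.
Qed.

(** Existence and uniqueness, with [int_poly_inj], of coordinates in the
    [Z]-basis of [Z[theta]] formed by the powers of [theta] below [deg f]. *)
Lemma int_poly_reduce (L : fieldExtType rat) (theta : L) (f : {poly int})
    (q : {poly int}) :
  minPoly 1 theta = map_poly intr f ->
  f \is monic ->
  exists2 q' : {poly int}, (size q' < size f)%N &
    (map_poly intr q').[theta] = (map_poly intr q : {poly L}).[theta].
Proof.
move=> minf f_monic; exists (Pdiv.Ring.rmodp q f).
  by rewrite Pdiv.Ring.ltn_rmodp monic_neq0.
rewrite {2}(Pdiv.RingMonic.rdivp_eq f_monic q) rmorphD rmorphM /= -minf.
by rewrite hornerD hornerM (rootP (root_minPoly _ _)) mulr0 add0r.
Qed.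

Lemma int_poly_inj (L : fieldExtType rat) (theta : L) (f : {poly int})
    (q1 q2 : {poly int}) :
  minPoly 1 theta = map_poly intr f ->
  (size q1 < size f)%N -> (size q2 < size f)%N ->
  (map_poly intr q1 : {poly L}).[theta] = (map_poly intr q2).[theta] -> q1 = q2.
Proof.
move=> minf sz1 sz2 eq12; apply/eqP; rewrite -subr_eq0.
have : map_poly intr f %| (map_poly intr (q1 - q2) : {poly rat}).
  apply: (root_dvd_rat minf).
  rewrite map_in_alg_intr rootE rmorphB hornerD hornerN.
  by rewrite /= eq12 subrr.
apply: contraTT => nz; apply/negP.
have inj0 (s : {poly int}) : size (map_poly intr s : {poly rat}) = size s.
  by apply: size_map_inj_poly => //; apply: intr_inj.
move/dvdp_leq; rewrite -size_poly_eq0 !inj0 size_poly_eq0 => /(_ nz).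
rewrite leqNgt (leq_ltn_trans (size_polyD _ _)) // gtn_max sz1 size_polyN //.
Qed.

(** * The index divides a power of the resultant *)

(** Such a [phi] embeds [G / H] into [A] as a subgroup, so Lagrange's theorem
    applies. *)
Lemma add_index_dvd_card (V : zmodType) (A : finZmodType) (G H : set V)
    (phi : V -> A) :
  G 0 -> (forall x y, G x -> G y -> G (x - y)) ->
  (forall x y, G x -> G y -> phi (x - y) = phi x - phi y) ->
  (forall x, G x -> phi x = 0 <-> H x) -> (H `<=` G)%classic ->
  (add_index G H %| #|A|)%N.
Proof.
move=> G0 GB phiB phi0 HG.
have subH x y : H x -> H y -> H (x - y).
  move=> Hx Hy; apply/phi0; first by apply: GB; apply: HG.
  by rewrite phiB ?(proj2 (phi0 _ _)) ?subrr //; apply: HG.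
have H0 : H 0 by apply/phi0 => //; rewrite -(subrr 0) phiB // subrr.
have coset_eq x y : G x -> G y ->
    (add_coset H x = add_coset H y) <-> phi x = phi y.
  move=> Gx Gy; split.
    move=> e; have : add_coset H y x by rewrite -e; exists 0 => //; rewrite addr0.
    case=> h Hh; move/eqP; rewrite addrC eq_sym -subr_eq => /eqP e'.
    apply/eqP; rewrite -subr_eq0 -phiB // e'; apply/eqP.
    by apply/phi0 => //; apply: HG.
  move=> e.
  have Hxy : H (x - y) by apply/phi0; [apply: GB | rewrite phiB // e subrr].
  have Hyx : H (y - x) by rewrite -opprB -sub0r; apply: subH.
  have HD u v : H u -> H v -> H (u + v).
    move=> Hu Hv; rewrite -[v]opprK; apply: (subH) => //.
    by rewrite -sub0r; apply: subH.
  apply/seteqP; split => z [h Hh <-].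
    by exists ((x - y) + h); [apply: HD | rewrite addrA subrKC].
  by exists ((y - x) + h); [apply: HD | rewrite addrA subrKC].
(* [I] is the image of [G], and [rep] a section of [phi] over it: the cosets
   of [H] are listed without repetition by [rep]. *)
pose I : {set A} := [set a | `[< exists2 x, G x & phi x = a >]].
have I_rep a : a \in I -> exists x, G x /\ phi x = a.
  by rewrite inE => /asboolP [x]; exists x.
have [rep repP] :
    {rep : A -> V & forall a, a \in I -> G (rep a) /\ phi (rep a) = a}.
  apply: (@choice _ _ (fun a x => a \in I -> G x /\ phi x = a)) => a.
  case: (boolP (a \in I)) => [/I_rep [x] |_]; first by exists x.
  by exists 0.
have I_group : group_set I.
  apply/group_setP; split.
    rewrite inE; apply/asboolP; exists 0 => //; exact/phi0.
  move=> a b /I_rep [x [Gx <-]] /I_rep [y [Gy <-]]; rewrite inE; apply/asboolP.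
  exists (x - (0 - y)); first by apply: (GB) => //; apply: GB.
  rewrite !phiB //; last exact: GB.
  by rewrite (proj2 (phi0 0 G0) H0) sub0r opprK.
suff -> : add_index G H = #|I|.
  by rewrite -cardsT; exact: (cardSg (finset.subsetT (Group I_group))).
rewrite /add_index.
have -> : [set add_coset H x | x in G]%classic =
    [set` [fset add_coset H (rep a) | a in I]%fset]%classic.
  apply/seteqP; split => C /=.
    case=> x Gx <-; apply/imfsetP; exists (phi x).
      by rewrite /= inE; apply/asboolP; exists x.
    have [|Gr er] := repP (phi x); first by rewrite inE; apply/asboolP; exists x.
    by apply/coset_eq.
  by case/imfsetP => a /= aI ->; exists (rep a) => //; case: (repP a aI).
rewrite set_fsetK card_in_imfset; first by rewrite /= cardE.
move=> a b /repP [Ga ea] /repP [Gb eb] /coset_eq; rewrite ea eb; exact.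
Qed.

Lemma Zp1_mulrz_eq0 (N : nat) (z : int) :
  (((Zp1 : 'I_N.+1) *~ z == 0) = (N.+1 %| z)%Z).
Proof.
have nat_case m : ((Zp1 : 'I_N.+1) *+ m == 0) = (N.+1 %| m)%N.
  by rewrite Zp_mulrn -val_eqE /= modnMml mul1n.
by case: z => m; rewrite ?NegzE ?mulrNz ?oppr_eq0 -?pmulrn nat_case.
Qed.

(** The coordinates of [D x] in the basis of powers of [theta], reduced modulo
    [D], all vanish exactly when [x] lies in [Z[theta]]. *)
Lemma add_index_int_adjoin_dvd (L : fieldExtType rat) (theta : L)
    (f : {poly int}) :
  minPoly 1 theta = map_poly intr f -> f \is monic -> (2 < size f)%N ->
  resultant f f^`() != 0 ->
  (add_index (ring_of_integers <<1; theta>>%AS) (int_adjoin theta)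
     %| `|resultant f f^`()| ^ (size f).-1)%N.
Proof.
move=> minf f_monic sz_f nz_D; set D := resultant _ _.
set G := ring_of_integers _; set H := int_adjoin _.
have theta_int : integralOver (intr : int -> L) theta.
  by exists f => //; rewrite -minf root_minPoly.
(* ['I_N.+1] is the additive group of integers modulo [N.+1], including the
   trivial group when [N = 0]. *)
have [N DN] : exists N, `|D|%N = N.+1.
  by exists `|D|.-1; rewrite prednK // absz_gt0.
have [psi psiP] : {psi : L -> {poly int} & forall x, G x ->
    (size (psi x) < size f)%N /\ (map_poly intr (psi x)).[theta] = x *~ D}.
  apply: (@choice _ _ (fun x (q : {poly int}) => G x ->
    (size q < size f)%N /\ (map_poly intr q).[theta] = x *~ D)) => x.
  have [[Kx intx]|notG] := EM (G x); last by exists 0.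
  have [q qx] := resultant_deriv_mul_integral minf f_monic sz_f nz_D Kx intx.
  have [q' sz_q' q'x] := int_poly_reduce q minf f_monic.
  by exists q'; rewrite q'x.
have GB x y : G x -> G y -> G (x - y).
  by move=> [Kx ix] [Ky iy]; split; [apply: rpredB | apply: integral_sub].
have HG : (H `<=` G)%classic.
  move=> _ [q _ <-]; split.
    by apply/Fadjoin_polyP; exists (map_poly intr q) => //; apply/polyOverP => i;
      rewrite coef_map /= rpred_int.
  apply: integral_horner => //; apply/integral_poly => i.
  by rewrite coef_map; apply: integral_id.
have size_sub (q1 q2 : {poly int}) :
    (size q1 < size f)%N -> (size q2 < size f)%N ->
    (size (q1 - q2)%R < size f)%N.
  move=> s1 s2.
  by rewrite (leq_ltn_trans (size_polyD _ _)) // gtn_max size_polyN s1.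
have psiB x y : G x -> G y -> psi (x - y) = psi x - psi y.
  move=> Gx Gy; have [sx ex] := psiP x Gx; have [sy ey] := psiP y Gy.
  have [sxy exy] := psiP _ (GB _ _ Gx Gy).
  apply: (int_poly_inj minf) => //; first exact: size_sub.
  by rewrite exy rmorphB hornerD hornerN /= ex ey mulrzBl.
pose phi x : 'rV['I_N.+1]_(size f).-1 :=
  \row_(i < (size f).-1) (Zp1 *~ (psi x)`_i).
have -> : (`|D| ^ (size f).-1)%N = #|{: 'rV['I_N.+1]_(size f).-1}|.
  by rewrite card_mx card_ord mul1n DN.
apply: (@add_index_dvd_card _ _ _ _ phi) => //.
- by split; [apply: rpred0 | apply: integral0].
- by move=> x y Gx Gy; apply/rowP => i; rewrite !mxE psiB // coefB mulrzBr.
move=> x Gx; have [sz_x ex] := psiP x Gx; split.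
  move/rowP => phi0.
  have dvdD i : (D %| (psi x)`_i)%Z.
    have [ltif|leif] := ltnP i (size f).-1.
      have := phi0 (Ordinal ltif); rewrite !mxE => /eqP.
      by rewrite Zp1_mulrz_eq0 -DN.
    rewrite nth_default ?dvdz0 // (leq_trans _ leif) // -ltnS prednK //.
    exact: leq_trans sz_f.
  pose q := map_poly (fun z => (z %/ D)%Z) (psi x).
  have qD : psi x = D *: q.
    by apply/polyP => i; rewrite coefZ coef_map_id0 ?div0z // mulrC divzK.
  exists q => //; apply: (mulIf (x := D%:~R)).
    by rewrite -(rmorph_int (in_alg L)) fmorph_eq0 intr_eq0.
  by rewrite /= [RHS]mulrzr -ex qD map_polyZ /= hornerZ mulrC.
case=> q _ qx; have [q' sz_q' q'x] := int_poly_reduce q minf f_monic.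
have psi_x : psi x = D *: q'.
  apply: (int_poly_inj minf) => //.
    by rewrite (leq_ltn_trans (size_scale_leq _ _)).
  by rewrite ex map_polyZ /= hornerZ q'x qx mulrC mulrzr.
apply/rowP => i; rewrite !mxE psi_x coefZ; apply/eqP.
by rewrite Zp1_mulrz_eq0 -DN dvdz_mulr // dvdzE.
Qed.

(** * Quadrinomials *)

Lemma quadrinomialP (n : nat) (a b c : int) : (2 < n)%N ->
  size (quadrinomial n a b c) = n.+1 /\ quadrinomial n a b c \is monic.
Proof.
move=> n_gt2; rewrite /quadrinomial.
rewrite -!addrA.
set r := (X in 'X^n + X).
have sz_r : (size r < size ('X^n : {poly int}))%N.
  rewrite size_polyXn ltnS /r.
  apply: leq_trans (size_polyD _ _) _; rewrite geq_max; apply/andP; split.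
    rewrite (leq_trans (size_scale_leq _ _)) // size_polyXn subn1 prednK //.
    exact: leq_trans n_gt2.
  apply: leq_trans (size_polyD _ _) _; rewrite geq_max; apply/andP; split.
    rewrite (leq_trans (size_scale_leq _ _)) // size_polyX.
    exact: leq_trans n_gt2.
  by rewrite (leq_trans (size_polyC_leq1 _)) // (leq_trans _ n_gt2).
by rewrite monicE size_polyDl // lead_coefDl // lead_coefXn size_polyXn.
Qed.

Lemma quadrinomial_coprime_deriv (F : fieldType) (n : nat) (a b c : F) :
  (2 < n)%N ->
  [/\ a != 0, c != 0, b = 0 & n%:R = 0 :> F] \/
  [/\ a != 0, b != 0, c = 0 & n%:R = 2 :> F] ->
  forall f, f = 'X^n + a *: 'X^(n - 1) + b *: 'X + c%:P -> coprimep f f^`().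
Proof.
case: n => [|[|[|n]]] // _ ab f; rewrite subn1 /= => fE.
have n1 : n.+2%:R = n.+3%:R - 1 :> F by rewrite -[n.+3]addn1 natrD addrK.
have f'E : f^`() = n.+3%:R *: 'X^(n.+2) + (a * n.+2%:R) *: 'X^(n.+1) + b%:P.
  rewrite fE !derivD !derivZ !derivXn derivX derivC addr0 /=.
  by rewrite -!scaler_nat scalerA alg_polyC.
case: ab => [[a0 c0 b0 n0] | [a0 b0 c0 n2]].
  have -> : f^`() = (- a) *: 'X^(n.+1).
    by rewrite f'E n1 n0 b0 sub0r mulrN1 scale0r add0r addr0.
  rewrite coprimepZr ?oppr_eq0 // coprimep_expr // coprimepX rootE fE b0.
  rewrite !(hornerD, hornerZ, hornerXn, hornerX, hornerC).
  by rewrite !expr0n /= !mulr0 !add0r.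
have fX : 'X * f^`() - f = 'X^(n.+3).
  rewrite f'E fE n1 n2 c0 scaler_nat addrK mulr1 addr0 -!mul_polyC !exprS. ring.
have f'X : coprimep f^`() 'X^(n.+3).
  rewrite coprimep_expr // coprimepX f'E rootE.
  rewrite !(hornerD, hornerZ, hornerXn, hornerX, hornerC).
  by rewrite !expr0n /= !mulr0 !add0r.
rewrite coprimep_sym; move: f'X; rewrite -fX.
by rewrite coprimep_addl_mul -scaleN1r coprimepZr // oppr_eq0 oner_eq0.
Qed.

Theorem proposition1p5 (n : nat) (a b c : int) (k : nat)
    (L : fieldExtType rat) (theta : L) (p : nat)
    (f := quadrinomial n a b c)
    (K := <<1; theta>>%AS : {subfield L})
    (D := discriminant f) :
  (4 < n)%N ->
  a * b * c != 0 ->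
  n%:Z ^+ 2 = a * k%:Z ->
  integralOver (intr : int -> L) theta ->
  minPoly 1 theta = map_poly intr f ->
  prime p -> odd p ->
  [/\ ~~ (p %| a)%Z, ~~ (p %| c)%Z, (p %| b)%Z & (p %| n)%N]
  \/ [/\ ~~ (p %| a)%Z, ~~ (p %| b)%Z, (p %| c)%Z & (p %| n - 2)%N] ->
  ~~ (p %| add_index (ring_of_integers K) (int_adjoin theta))%N
  /\ ~~ (p %| D)%Z.
Proof.
move=> n_gt4 _ _ _ minf p_prime _ cond.
have n_gt2 : (2 < n)%N := ltnW (ltnW n_gt4).
have [sz_f f_monic] := quadrinomialP a b c n_gt2.
have res_p : ~~ (p %| resultant f f^`())%Z.
  have chp := pchar_Fp p_prime.
  have Fp0 (z : int) : (z%:~R == 0 :> 'F_p) = (p %| z)%Z.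
    case: z => m; rewrite ?NegzE ?rmorphN ?oppr_eq0 /=;
    by rewrite ?[(p %| - _)%Z]dvdzE ?abszN -(dvdn_pcharf chp).
  rewrite -Fp0; apply: resultant_map_neq0 => //.
  have fpE : map_poly intr f =
      'X^n + a%:~R *: 'X^(n - 1) + b%:~R *: 'X + (c%:~R)%:P :> {poly 'F_p}.
    rewrite /f /quadrinomial !rmorphD /= !map_polyZ /= !map_polyXn.
    by rewrite map_polyX map_polyC.
  rewrite -deriv_map; apply: (quadrinomial_coprime_deriv n_gt2 _ fpE).
  have Fp0P (z : int) : (p %| z)%Z -> z%:~R = 0 :> 'F_p by rewrite -Fp0 => /eqP.
  case: cond => [[pa pc pb pn] | [pa pb pc pn]]; [left | right].
    by split; rewrite ?Fp0 //; [exact: Fp0P | exact: (Fp0P n%:Z)].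
  split; rewrite ?Fp0 //; first exact: Fp0P.
  apply/eqP; rewrite -subr_eq0 -natrB -?(dvdn_pcharf chp) //.
  exact: ltnW n_gt2.
have nz_res : resultant f f^`() != 0.
  by apply: contraNneq res_p => ->; rewrite dvdz0.
split.
  have sz2 : (2 < size f)%N by rewrite sz_f ltnS ltnW.
  have := add_index_int_adjoin_dvd minf f_monic sz2 nz_res.
  move=> index_dvd; apply: contra res_p => /dvdn_trans /(_ index_dvd).
  by rewrite Euclid_dvdX // dvdzE => /andP [].
rewrite /D /discriminant (monicP f_monic) divz1.
by rewrite dvdzE abszMsign -dvdzE.
Qed.
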